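(* Let $\mathcal{P}$ be a finite simple type system on $\Omega$. Then $\operatorname{Stab}_V(\mathcal{P})$ is a maximal subgroup of Thompson's group $V$.
   Context: $\mathfrak{C}$ is the Cantor space of infinite words over $\{0,1\}$ and $\Omega$ is the set of all finite words over $\{0,1\}$ (including the empty word), called addresses. For $\alpha\in\Omega$ the cone is $\alpha\mathfrak{C}=\{\alpha w\mid w\in\mathfrak{C}\}$. Thompson's group $V$ is the group (under composition) of all maps $\mathfrak{C}\to\mathfrak{C}$ for which there are two partitions $\alpha_1\mathfrak{C},\dots,\alpha_n\mathfrak{C}$ and $\beta_1\mathfrak{C},\dots,\beta_n\mathfrak{C}$ of $\mathfrak{C}$ into disjoint cones such that $\alpha_iw\mapsto\beta_iw$ for all $i$ and all $w\in\mathfrak{C}$. $V$ acts partially on $\Omega$ on the right: for $g\in V$, $\alpha^g=\beta$ if $g$ maps $\alpha w\mapsto\beta w$ for all $w\in\mathfrak{C}$; if there is no such $\beta$, then $\alpha^g$ is undefined. A type system on $\Omega$ is the partition $\mathcal{P}$ of $\Omega$ into the classes (called types) of an equivalence relation $\sim$ such that for all $\alpha,\beta\in\Omega$: $\alpha\sim\beta$ if and only if both $\alpha0\sim\beta0$ and $\alpha1\sim\beta1$. It is finite if it has only finitely many classes. A type system $\mathcal{Q}$ (relation $\approx$) is a quotient of $\mathcal{P}$ (relation $\sim$) if $\alpha\sim\beta$ implies $\alpha\approx\beta$; it is a proper quotient if moreover $\mathcal{Q}\neq\mathcal{P}$. The universal relation is the one in which all addresses are related. $\mathcal{P}$ is simple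 if its only proper quotient is the type system of the universal relation (in particular the universal type system itself, having no proper quotient, is not simple). $\operatorname{Stab}_V(\mathcal{P})$ is the subgroup of all $g\in V$ for which there is a cofinite subset $\Omega_0\subseteq\Omega$ such that $\alpha^g$ is defined for all $\alpha\in\Omega_0$ and, for all $\alpha,\beta\in\Omega_0$, $\alpha\sim\beta$ if and only if $\alpha^g\sim\beta^g$. *)

(* Defs.v *)
From Corelib Require RelationClasses.
From HB Require Import structures.
From mathcomp Require Import all_boot.
From mathcomp Require Import boolp classical_sets functions cardinality.

Set Implicit Arguments.
Unset Strict Implicit.
Unset Printing Implicit Defensive.

Local Open Scope classical_set_scope.

(* Only the underlying set of the Cantor space is used, not its topology. *)
Definition cantor : Type := nat -> bool.

Definition address : Type := seq bool.

(* The infinite word [a w]: [nth] falls back on [w (n - size a)] past the end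
   of [a]. *)
Definition prepend (a : address) (w : cantor) : cantor :=
  fun n => nth (w (n - size a)) a n.

Definition cone (a : address) : set cantor := range (prepend a).

Definition cone_partition (n : nat) (a : 'I_n -> address) : Prop :=
  partition [set: 'I_n] (fun i => cone (a i)) [set: cantor].

Definition is_thompson (g : cantor -> cantor) : Prop :=
  exists (n : nat) (a b : 'I_n -> address),
    [/\ cone_partition a, cone_partition b &
        forall i w, g (prepend (a i) w) = prepend (b i) w].

Lemma prepend_cat a b w : prepend (a ++ b) w = prepend a (prepend b w).
Proof.
apply/funext => n; rewrite /prepend nth_cat size_cat subnDA.
case: ltnP => [lt_na|le_an]; first exact: set_nth_default.
by rewrite [RHS]nth_default.
Qed.

Lemma prepend0 w : prepend [::] w = w.
Proof. by apply/funext => n; rewrite /prepend nth_nil subn0. Qed.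

Lemma prepend_inj a : injective (prepend a).
Proof.
move=> v w /funeqP eq_vw; apply/funext => n.
have := eq_vw (size a + n); rewrite /prepend !nth_default ?leq_addr //.
by rewrite addKn.
Qed.

Lemma prepend_prefix a b v w :
  prepend a v = prepend b w -> size a <= size b -> prefix a b.
Proof.
move=> /funeqP eq_vw le_ab; rewrite prefixE; apply/eqP.
apply: (@eq_from_nth _ false); first by rewrite size_takel.
move=> i; rewrite size_takel // => lt_ia; rewrite nth_take //.
have := eq_vw i; rewrite /prepend (set_nth_default false) // => ->.
by rewrite (set_nth_default false) // (leq_trans lt_ia).
Qed.

Lemma prepend_comparable a b v w :
  prepend a v = prepend b w -> prefix a b || prefix b a.
Proof.
move=> eq_vw; case: (leqP (size a) (size b)) => [|/ltnW] le_ab.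
  by rewrite (prepend_prefix eq_vw).
by rewrite (prepend_prefix (esym eq_vw)) ?orbT.
Qed.

Lemma cat_drop_comparable (a b : address) :
  prefix a b || prefix b a -> a ++ drop (size a) b = b ++ drop (size b) a.
Proof.
by case/orP => /prefixP [c ->]; rewrite drop_size_cat // drop_oversize ?cats0
  // size_cat leq_addr.
Qed.

Lemma cone_partitionP n (a : 'I_n -> address) :
  (forall w, exists i v, w = prepend (a i) v) ->
  (forall i j v w, prepend (a i) v = prepend (a j) w -> i = j) ->
  cone_partition a.
Proof.
move=> a_cover a_triv; split.
- rewrite -subTset => w _; have [i [v ->]] := a_cover w.
  by exists i => //; exists v.
- by move=> i j _ _ [w [[u _ <-] [v _ /esym/a_triv]]].
- by move=> i _; exists (prepend (a i) (fun=> false)); eexists.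
Qed.

Lemma cone_partition_cover n (a : 'I_n -> address) :
  cone_partition a -> forall w, exists i v, w = prepend (a i) v.
Proof.
move=> [a_cover _ _] w; have : [set: cantor] w by [].
by rewrite -a_cover => -[i _ [v _ <-]]; exists i, v.
Qed.

Lemma cone_partition_triv n (a : 'I_n -> address) : cone_partition a ->
  forall i j v w, prepend (a i) v = prepend (a j) w -> i = j.
Proof.
move=> [_ a_triv _] i j v w eq_vw; apply: a_triv => //.
by exists (prepend (a i) v); split; [exists v | exists w].
Qed.

Lemma prepend_split a b v w : prepend a v = prepend b w ->
  exists u, v = prepend (drop (size a) b) u /\ w = prepend (drop (size b) a) u.
Proof.
move=> eq_vw; case/orP: (prepend_comparable eq_vw) => /prefixP [c def_c].
  exists w; rewrite def_c drop_size_cat // drop_oversize ?size_cat ?leq_addr //.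
  split; last by rewrite prepend0.
  by apply: (@prepend_inj a); rewrite eq_vw def_c prepend_cat.
exists v; rewrite def_c drop_size_cat // drop_oversize ?size_cat ?leq_addr //.
split; first by rewrite prepend0.
by apply: (@prepend_inj b); rewrite -eq_vw def_c prepend_cat.
Qed.

(* If [f] maps the cone of [a i] to that of [b i] and [g] the cone of [c j] to
   that of [d j], then the cones of [refine a b c (i, j)], for [b i] and [c j]
   comparable, are the common refinement of the cones of [a] and of the
   preimages under [f] of the cones of [c]. *)
Definition refine n m (a b : 'I_n -> address) (c : 'I_m -> address)
  (p : 'I_n * 'I_m) : address := a p.1 ++ drop (size (b p.1)) (c p.2).

Definition overlap n m (b : 'I_n -> address) (c : 'I_m -> address)
  : {set 'I_n * 'I_m} :=
  [set p | prefix (b p.1) (c p.2) || prefix (c p.2) (b p.1)]%SET.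

Lemma refine_partition n m (a b : 'I_n -> address) (c : 'I_m -> address) :
  cone_partition a -> cone_partition c ->
  cone_partition (fun k : 'I_#|overlap b c| => refine a b c (enum_val k)).
Proof.
move=> pa pc; apply: cone_partitionP => [w|k l v w].
  have [i [v ->]] := cone_partition_cover pa w.
  have [j [u eq_vu]] := cone_partition_cover pc (prepend (b i) v).
  have ij : (i, j) \in overlap b c by rewrite inE /= (prepend_comparable eq_vu).
  have [x [-> _]] := prepend_split eq_vu.
  exists (enum_rank_in ij (i, j)), x.
  by rewrite enum_rankK_in // /refine prepend_cat.
rewrite /refine !prepend_cat => eq_vw; apply: enum_val_inj.
move: (enum_valP k) (enum_valP l) eq_vw.
case: (enum_val k) (enum_val l) => [i j] [i' j'] /=; rewrite !inE /=.
move=> /cat_drop_comparable bc /cat_drop_comparable bc' eq_vw.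
have eq_i := cone_partition_triv pa eq_vw; subst i'.
move/prepend_inj/(congr1 (prepend (b i))): eq_vw.
rewrite -!prepend_cat bc bc' !prepend_cat => /(cone_partition_triv pc) -> //.
Qed.

Lemma is_thompson_id : is_thompson id.
Proof.
have p1 : cone_partition (fun _ : 'I_1 => [::]).
  apply: cone_partitionP => [w|i j _ _ _]; last by rewrite !ord1.
  by exists ord0, w; rewrite prepend0.
by exists 1, (fun=> [::]), (fun=> [::]).
Qed.

Lemma is_thompson_comp f g :
  is_thompson f -> is_thompson g -> is_thompson (g \o f).
Proof.
move=> [n [a [b [pa pb fE]]]] [m [c [d [pc pd gE]]]].
exists #|overlap b c|, (fun k => refine a b c (enum_val k)),
  (fun k => d (enum_val k).2 ++
            drop (size (c (enum_val k).2)) (b (enum_val k).1)); split.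
- exact: refine_partition.
- apply: cone_partitionP => [w|k l v w].
    have [j [u ->]] := cone_partition_cover pd w.
    have [i [v eq_uv]] := cone_partition_cover pb (prepend (c j) u).
    have ij : (i, j) \in overlap b c.
      by rewrite inE /= orbC (prepend_comparable eq_uv).
    have [x [-> _]] := prepend_split eq_uv.
    exists (enum_rank_in ij (i, j)), x.
    by rewrite enum_rankK_in // prepend_cat.
  rewrite !prepend_cat => eq_vw; apply: enum_val_inj.
  move: (enum_valP k) (enum_valP l) eq_vw.
  case: (enum_val k) (enum_val l) => [i j] [i' j'] /=; rewrite !inE /=.
  move=> /cat_drop_comparable bc /cat_drop_comparable bc' eq_vw.
  have eq_j := cone_partition_triv pd eq_vw; subst j'.
  move/prepend_inj/(congr1 (prepend (c j))): eq_vw.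
  by rewrite -!prepend_cat -bc -bc' !prepend_cat => /(cone_partition_triv pb) ->.
- move=> k w; move: (enum_valP k); case: (enum_val k) => [i j] /=.
  rewrite inE /= => /cat_drop_comparable bc.
  by rewrite /refine /= prepend_cat fE -prepend_cat bc !prepend_cat gE.
Qed.

Lemma is_thompson_inv f :
  is_thompson f -> exists g, [/\ is_thompson g, cancel f g & cancel g f].
Proof.
move=> [n [a [b [pa pb fE]]]].
have hasinv z : exists y, exists i v, z = prepend (b i) v /\ y = prepend (a i) v.
  have [i [v zE]] := cone_partition_cover pb z.
  by exists (prepend (a i) v), i, v.
pose g z := sval (cid (hasinv z)).
have gE i w : g (prepend (b i) w) = prepend (a i) w.
  rewrite /g; case: cid => y /= [j [v [eq_wv ->]]].
  have eq_ij := cone_partition_triv pb eq_wv; subst j.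
  by move/prepend_inj: eq_wv => ->.
exists g; split; first by exists n, b, a.
- move=> w; have [i [v ->]] := cone_partition_cover pa w.
  by rewrite fE gE.
- move=> w; have [i [v ->]] := cone_partition_cover pb w.
  by rewrite gE fE.
Qed.

Record thompson : Type := Thompson {
  thompson_fun :> cantor -> cantor;
  thompsonP : is_thompson thompson_fun
}.

Lemma thompson_eqP (f g : thompson) : (f : cantor -> cantor) = g -> f = g.
Proof.
case: f g => [f f_V] [g g_V] /= eq_fg; subst g.
by congr Thompson; apply: Prop_irrelevance.
Qed.

Definition thompson_one : thompson := Thompson is_thompson_id.

(* Maps act on the right: [thompson_mul f g] is [f] followed by [g]. *)
Definition thompson_mul (f g : thompson) : thompson :=
  Thompson (is_thompson_comp (thompsonP f) (thompsonP g)).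

Definition thompson_inv (f : thompson) : thompson :=
  let: exist _ g_inv := cid (is_thompson_inv (thompsonP f)) in
  let: And3 g_V _ _ := g_inv in Thompson g_V.

Lemma thompson_mulA : associative thompson_mul.
Proof. by move=> f g h; apply: thompson_eqP. Qed.

Lemma thompson_mul1g : left_id thompson_one thompson_mul.
Proof. by move=> f; apply: thompson_eqP. Qed.

Lemma thompson_mulg1 : right_id thompson_one thompson_mul.
Proof. by move=> f; apply: thompson_eqP. Qed.

Lemma thompson_mulVg : left_inverse thompson_one thompson_inv thompson_mul.
Proof.
move=> f; apply: thompson_eqP; apply/funext => w /=.
by rewrite /thompson_inv; case: cid => g [g_V fK gK] /=; apply: gK.
Qed.

Lemma thompson_mulgV : right_inverse thompson_one thompson_inv thompson_mul.
Proof.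
move=> f; apply: thompson_eqP; apply/funext => w /=.
by rewrite /thompson_inv; case: cid => g [g_V fK gK] /=; apply: fK.
Qed.

HB.instance Definition _ := gen_eqMixin thompson.
HB.instance Definition _ := gen_choiceMixin thompson.
HB.instance Definition _ := isGroup.Build thompson
  thompson_mulA thompson_mul1g thompson_mulg1 thompson_mulVg thompson_mulgV.

Definition subgroup (G : groupType) (H : set G) : Prop := group_closed (mem H).

Definition maximal_subgroup (G : groupType) (H : set G) : Prop :=
  [/\ subgroup H, H <> [set: G] &
      forall K : set G, subgroup K -> H `<=` K -> K = H \/ K = [set: G]].

(* The partial action on addresses as a graph: [acts g a b] holds when the
   image of [a] under [g] is defined and equal to [b]. *)
Definition acts (g : cantor -> cantor) (a b : address) : Prop :=
  forall w, g (prepend a w) = prepend b w.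

Lemma prepend_addr_inj a b : (forall w, prepend a w = prepend b w) -> a = b.
Proof.
have le_size c d : (forall w, prepend c w = prepend d w) -> size c <= size d.
  move=> eq_cd; rewrite leqNgt; apply/negP => lt_dc.
  have := congr1 (@^~ (size d)) (eq_cd (fun=> ~~ nth false c (size d))).
  rewrite /prepend [RHS]nth_default // (set_nth_default false) //.
  by case: nth.
move=> eq_ab; have eq_size : size a = size b.
  by apply/eqP; rewrite eqn_leq !le_size.
apply: (@eq_from_nth _ false) => // i lt_ia.
have := congr1 (@^~ i) (eq_ab (fun=> false)); rewrite /prepend.
by [].
Qed.

Lemma acts_uniq g a b c : acts g a b -> acts g a c -> b = c.
Proof. by move=> gb gc; apply: prepend_addr_inj => w; rewrite -gb gc. Qed.

Record type_system : Type := TypeSystem {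
  type_rel :> address -> address -> Prop;
  type_rel_equiv : RelationClasses.Equivalence type_rel;
  type_rel_children : forall a b, type_rel a b <->
    type_rel (rcons a false) (rcons b false) /\
    type_rel (rcons a true) (rcons b true)
}.

Definition types (P : type_system) : set (set address) :=
  range (fun a => [set b | P a b]).

Definition finite_type_system (P : type_system) : Prop :=
  finite_set (types P).

Definition quotient_of (Q P : type_system) : Prop :=
  forall a b, P a b -> Q a b.

Definition proper_quotient (Q P : type_system) : Prop :=
  quotient_of Q P /\ types Q <> types P.

Definition universal (P : type_system) : Prop := forall a b, P a b.

Definition simple_type_system (P : type_system) : Prop :=
  forall Q, proper_quotient Q P <-> universal Q.

Definition stabilizer (P : type_system) : set thompson :=
  [set g | exists2 A : set address, finite_set (~` A) &
     (forall a, A a -> exists a', acts g a a') /\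
     (forall a b a' b', A a -> A b -> acts g a a' -> acts g b b' ->
        (P a b <-> P a' b'))].

(* Main.v *)
(* An address is roomy if its type recurs at two incomparable descendants. As
   there are finitely many types, any few deep addresses leave room for a further,
   arbitrarily deep, address of any given roomy type. The stabilizer H contains
   the swap of any two incomparable addresses of the same type. Let K properly
   contain H.

   If all deep addresses are roomy, conjugating such swaps by an element of K
   outside H yields a swap in K of two addresses of different types. Because of
   the room available, membership in K of the swap of two deep incomparable
   addresses depends only on their types, and "interchangeable by K" is an
   equivalence compatible with taking children; simplicity forces it to become
   universal eventually, so K contains all swaps.

   Otherwise, simplicity forces all but finitely many nonconstant addresses (those
   whose type is not the type of all their descendants) to have exactly one
   nonconstant child, all constant addresses to have the same type, and types to
   be determined by which descendants are constant. So some element of K takes a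
   constant address to a nonconstant one, whence K contains the swap of a
   nonconstant and a constant address; this spreads up and down the paths of
   nonconstant addresses, and again K contains all deep swaps.

   Finally the swaps generate V: swaps bring a caret of the domain partition onto
   a caret of the range partition, and merging both decreases the number of
   cones. *)

Require Import Defs.
From mathcomp Require Import all_boot.
From mathcomp Require Import boolp classical_sets cardinality.
From mathcomp Require Import fingroup perm zify.

Set Implicit Arguments.
Unset Strict Implicit.
Unset Printing Implicit Defensive.

Local Open Scope nat_scope.

(** * Incomparable addresses and the partial action *)

Definition incomp (a b : address) : bool := ~~ (prefix a b || prefix b a).

Lemma incompC a b : incomp a b = incomp b a.
Proof. by rewrite /incomp orbC. Qed.

Lemma incompP a b : reflect (forall v w, prepend a v <> prepend b w) (incomp a b).
Proof.
apply: (iffP idP) => [/negP ab v w /prepend_comparable //|ab].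
apply/negP => /cat_drop_comparable eq_ab.
apply: (ab (prepend (drop (size a) b) xpred0) (prepend (drop (size b) a) xpred0)).
by rewrite -!prepend_cat eq_ab.
Qed.

Lemma incomp_catl a b u : incomp a b -> incomp (a ++ u) b.
Proof. by move=> /incompP ab; apply/incompP => v w; rewrite prepend_cat. Qed.

Lemma incomp_catr a b u : incomp a b -> incomp a (b ++ u).
Proof. by rewrite ![incomp a _]incompC; exact: incomp_catl. Qed.

Lemma incomp_cat2l a u v : incomp (a ++ u) (a ++ v) = incomp u v.
Proof. by rewrite /incomp !prefix_catr ?eqxx. Qed.

Lemma comparable_le a b : ~~ incomp a b -> size a <= size b ->
  exists u, b = a ++ u.
Proof.
move=> /negPn /orP[/prefixP //|/prefixP [u ->]]; rewrite size_cat.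
rewrite -[leqRHS]addn0 leq_add2l leqn0.
by move=> /nilP ->; exists [::]; rewrite !cats0.
Qed.

Lemma acts_cat g a b u : acts g a b -> acts g (a ++ u) (b ++ u).
Proof. by move=> gab w; rewrite !prepend_cat gab. Qed.

Lemma acts_mul (f g : thompson) a b c :
  acts f a b -> acts g b c -> acts (f * g)%g a c.
Proof. by move=> fab gbc w /=; rewrite fab gbc. Qed.

Lemma thompson_invE (g : thompson) w : (g^-1)%g (g w) = w.
Proof. exact: (congr1 (fun f : thompson => f w) (mulgV g)). Qed.

Lemma thompson_Einv (g : thompson) w : g ((g^-1)%g w) = w.
Proof. exact: (congr1 (fun f : thompson => f w) (mulVg g)). Qed.

Lemma acts_inv (g : thompson) a b : acts g a b -> acts (g^-1)%g b a.
Proof. by move=> gab w; rewrite -gab thompson_invE. Qed.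

Lemma acts_incomp (g : thompson) a b a' b' : acts g a a' -> acts g b b' ->
  incomp a b -> incomp a' b'.
Proof.
move=> ga gb /incompP ab; apply/incompP => v w; rewrite -ga -gb.
move=> /(congr1 (g^-1)%g); rewrite !thompson_invE; exact: ab.
Qed.

Lemma partition_comparable n (a : 'I_n -> address) : cone_partition a ->
  forall b, exists i, ~~ incomp (a i) b.
Proof.
move=> pa b; have [i [v bE]] := cone_partition_cover pa (prepend b xpred0).
by exists i; apply/incompP => ab; apply: (ab v xpred0).
Qed.

Lemma partition_incomp n (a : 'I_n -> address) : cone_partition a ->
  forall i j, i != j -> incomp (a i) (a j).
Proof.
move=> pa i j ij; apply/incompP => v w /(cone_partition_triv pa) eq_ij.
by rewrite eq_ij eqxx in ij.
Qed.

Lemma partition_of_incomp n (a : 'I_n -> address) :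
  (forall w, exists i v, w = prepend (a i) v) ->
  (forall i j, i != j -> incomp (a i) (a j)) -> cone_partition a.
Proof.
move=> a_cover a_inc; apply: cone_partitionP => // i j v w eq_vw.
by apply/eqP/negPn/negP => /a_inc /incompP /(_ v w).
Qed.

(** Beyond the longest word of the domain partition every address extends some [a i], and the [m]
    further letters survive in the image. *)
Lemma acts_deep (g : thompson) m : exists M, forall a, M <= size a ->
  exists2 a', acts g a a' & m <= size a'.
Proof.
have [n [a [b [pa pb gE]]]] := thompsonP g.
exists (\max_i size (a i) + m) => c le_c.
have [i] := partition_comparable pa c.
have le_i : size (a i) <= \max_i size (a i) by apply: leq_bigmax.
case/comparable_le => [|u cE]; first by apply: leq_trans le_c; lia.
exists (b i ++ u); first by rewrite cE; apply: acts_cat; apply: gE.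
by move: le_c; rewrite cE !size_cat; lia.
Qed.

Definition shift (k : nat) (w : cantor) : cantor := fun n => w (k + n).

Lemma prepend_shift k w : prepend (mkseq w k) (shift k w) = w.
Proof.
apply/funext => n; rewrite /prepend /shift size_mkseq.
by case: (ltnP n k) => kn; [rewrite nth_mkseq|rewrite nth_default ?size_mkseq // subnKC].
Qed.

Lemma mkseq_prepend a w : mkseq (prepend a w) (size a) = a.
Proof.
apply: (@eq_from_nth _ false); rewrite size_mkseq // => i lt_i.
by rewrite nth_mkseq // /prepend (set_nth_default false).
Qed.

Lemma shift_prepend a w : shift (size a) (prepend a w) = w.
Proof. by apply: (@prepend_inj a); rewrite -{1}(mkseq_prepend a w) prepend_shift. Qed.

Lemma in_cone a w : mkseq w (size a) = a -> w = prepend a (shift (size a) w).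
Proof. by move=> aE; rewrite -{1}aE prepend_shift. Qed.

Lemma is_thompson_of_depth (f : cantor -> cantor) N : bijective f ->
  (forall u, size u = N -> exists u', acts f u u') -> is_thompson f.
Proof.
move=> [f' fK f'K] fN.
pose a (i : 'I_#|{: N.-tuple bool}|) : address := enum_val i.
have hb i : {b | acts f (a i) b} by apply: cid; apply: fN; rewrite size_tuple.
have a_cover w : exists i v, w = prepend (a i) v.
  have szu : size (mkseq w N) == N by rewrite size_mkseq.
  exists (enum_rank (Tuple szu)), (shift N w).
  by rewrite /a enum_rankK /= prepend_shift.
have a_triv i j v w : prepend (a i) v = prepend (a j) w -> i = j.
  move=> eq_vw; apply: enum_val_inj; apply: val_inj => /=.
  have := mkseq_prepend (a i) v; rewrite eq_vw.
  have -> : size (a i) = size (a j) by rewrite !size_tuple.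
  by rewrite mkseq_prepend.
exists _, a, (fun i => sval (hb i)); split.
- exact: cone_partitionP.
- apply: cone_partitionP => [w|i j v w].
    have [i [v wE]] := a_cover (f' w); exists i, v.
    by case: (hb i) => b /= <-; rewrite -wE f'K.
  case: (hb i) (hb j) => b fb [b' fb'] /=; rewrite -fb -fb'.
  by move=> /(can_inj fK) /a_triv.
- by move=> i w; case: (hb i).
Qed.

(** * Swaps *)

(* The identity when a and b are comparable. *)
Definition swap_fun (a b : address) (w : cantor) : cantor :=
  if ~~ incomp a b then w else
  if mkseq w (size a) == a then prepend b (shift (size a) w) else
  if mkseq w (size b) == b then prepend a (shift (size b) w) else w.

Lemma swap_funl a b w : incomp a b -> swap_fun a b (prepend a w) = prepend b w.
Proof. by move=> ab; rewrite /swap_fun ab /= mkseq_prepend eqxx shift_prepend. Qed.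

Lemma swap_funr a b w : incomp a b -> swap_fun a b (prepend b w) = prepend a w.
Proof.
move=> ab; rewrite /swap_fun ab /= mkseq_prepend eqxx shift_prepend.
by case: eqP => // /in_cone /esym E; move/incompP: ab => /(_ _ _ E).
Qed.

Lemma swap_fun_out a b w : (forall v, w <> prepend a v) ->
  (forall v, w <> prepend b v) -> swap_fun a b w = w.
Proof.
move=> wa wb; rewrite /swap_fun; case: ifP => // _.
by case: eqP => [/in_cone /wa //|_]; case: eqP => [/in_cone /wb //|_].
Qed.

Variant swap_cases_spec a b w : Type :=
  | SwapL v of w = prepend a v
  | SwapR v of w = prepend b v
  | SwapOut of (forall v, w <> prepend a v) & (forall v, w <> prepend b v).

Lemma swap_cases a b w : swap_cases_spec a b w.
Proof.
have [/in_cone|na] := eqVneq (mkseq w (size a)) a; first exact: SwapL.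
have [/in_cone|nb] := eqVneq (mkseq w (size b)) b; first exact: SwapR.
by apply: SwapOut => v wE; [move: na | move: nb];
  rewrite wE mkseq_prepend eqxx.
Qed.

Lemma swap_funK a b : involutive (swap_fun a b).
Proof.
move=> w; have [ab|ab] := boolP (incomp a b); last by rewrite /swap_fun ab.
case: (swap_cases a b w) => [v ->|v ->|wa wb].
- by rewrite swap_funl ?swap_funr.
- by rewrite swap_funr ?swap_funl.
- by rewrite !swap_fun_out.
Qed.

Lemma swap_fun_acts_out a b c : incomp c a -> incomp c b ->
  acts (swap_fun a b) c c.
Proof. by move=> /incompP ca /incompP cb w; rewrite swap_fun_out. Qed.


Lemma is_thompson_swap a b : is_thompson (swap_fun a b).
Proof.
apply: (@is_thompson_of_depth _ (maxn (size a) (size b))).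
  by exists (swap_fun a b); apply: swap_funK.
move=> u szu; have [ab|ab] := boolP (incomp a b); last first.
  by exists u => w; rewrite /swap_fun ab.
have [au|/comparable_le[|v ->]] := boolP (incomp a u); last 2 first.
- by rewrite szu leq_maxl.
- by exists (b ++ v) => w; rewrite !prepend_cat swap_funl.
have [bu|/comparable_le[|v ->]] := boolP (incomp b u); last 2 first.
- by rewrite szu leq_maxr.
- by exists (a ++ v) => w; rewrite !prepend_cat swap_funr.
by exists u; apply: swap_fun_acts_out; rewrite incompC.
Qed.

Definition swap (a b : address) : thompson := Thompson (is_thompson_swap a b).

Lemma swapl a b : incomp a b -> acts (swap a b) a b.
Proof. by move=> ab w; apply: swap_funl. Qed.

Lemma swapr a b : incomp a b -> acts (swap a b) b a.
Proof. by move=> ab w; apply: swap_funr. Qed.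

Lemma swap_out a b c : incomp c a -> incomp c b -> acts (swap a b) c c.
Proof. exact: swap_fun_acts_out. Qed.

Lemma swapC a b : swap a b = swap b a.
Proof.
apply: thompson_eqP; apply/funext => w /=.
have [ab|ab] := boolP (incomp a b); last first.
  by rewrite /swap_fun (incompC b) ab.
have ba : incomp b a by rewrite incompC.
case: (swap_cases a b w) => [v ->|v ->|wa wb].
- by rewrite swap_funl ?swap_funr.
- by rewrite swap_funr ?swap_funl.
- by rewrite !swap_fun_out.
Qed.

Lemma swap_conj (g : thompson) a b a' b' : incomp a b -> acts g a a' ->
  acts g b b' -> swap a' b' = (g^-1 * swap a b * g)%g.
Proof.
move=> ab ga gb; have a'b' := acts_incomp ga gb ab.
apply: thompson_eqP; apply/funext => w.
change (swap_fun a' b' w = g (swap_fun a b ((g^-1)%g w))).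
case: (swap_cases a' b' w) => [v ->|v ->|wa wb].
- by rewrite (acts_inv ga) !swap_funl // gb.
- by rewrite (acts_inv gb) !swap_funr // ga.
- rewrite !swap_fun_out ?thompson_Einv // => v /(congr1 g);
  rewrite thompson_Einv ?ga ?gb; [exact: wa|exact: wb].
Qed.

(** Splitting a pair into its children lets membership in a subgroup climb from deep swaps to
    shallow ones. *)
Lemma swap_children a b : incomp a b ->
  swap a b = (swap (a ++ [:: false]) (b ++ [:: false]) *
              swap (a ++ [:: true]) (b ++ [:: true]))%g.
Proof.
move=> ab; have inc c d : incomp (a ++ [:: c]) (b ++ [:: d]).
  by apply: incomp_catl; apply: incomp_catr.
apply: thompson_eqP; apply/funext => w.
have split0 v : v = prepend [:: v 0] (shift 1 v).
  by rewrite -[LHS](prepend_shift 1).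
rewrite [LHS]/= [RHS]/=.
have outa v c d : swap_fun (a ++ [:: c]) (b ++ [:: c]) (prepend (a ++ [:: d]) v) =
    if c == d then prepend (b ++ [:: c]) v else prepend (a ++ [:: d]) v.
  case: eqP => [<-|cd]; first by rewrite swap_funl.
  by apply: swap_out; rewrite // incomp_cat2l; case: c d cd => [] [].
have outb v c d : swap_fun (a ++ [:: c]) (b ++ [:: c]) (prepend (b ++ [:: d]) v) =
    if c == d then prepend (a ++ [:: c]) v else prepend (b ++ [:: d]) v.
  case: eqP => [<-|cd]; first by rewrite swap_funr.
  apply: swap_out; rewrite 1?incompC // incomp_cat2l; by case: c d cd => [] [].
case: (swap_cases a b w) => [v ->|v ->|wa wb].
- rewrite swap_funl // (split0 v) -!prepend_cat.
  by case: (v 0); rewrite !outa /= ?outb ?outa.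
- rewrite swap_funr // (split0 v) -!prepend_cat.
  by case: (v 0); rewrite !outb /= ?outb ?outa.
- by rewrite !swap_fun_out // => v; rewrite prepend_cat //.
Qed.

Section Subgroup.

Variables (K : set thompson).
Hypothesis subK : subgroup K.

Lemma mem1K : K 1%g.
Proof. by have [/set_mem] := subK. Qed.

Lemma memMK f g : K f -> K g -> K (f * g)%g.
Proof.
move=> Kf Kg; apply/set_mem/(group_closedM subK); exact/mem_set.
Qed.

Lemma memVK f : K f -> K f^-1%g.
Proof.
move=> Kf; apply/set_mem/(group_closedV subK); exact/mem_set.
Qed.

End Subgroup.

(** * Generation by swaps *)

Lemma prepend_child a v :
  prepend a v = prepend (a ++ [:: v 0]) (shift 1 v).
Proof. by rewrite prepend_cat -[v in LHS](prepend_shift 1). Qed.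

Lemma incomp_children a b :
  (forall c, incomp (a ++ [:: c]) b) -> incomp a b.
Proof.
move=> ab; apply/incompP => v w; rewrite prepend_child.
by have /incompP := ab (v 0); apply.
Qed.

Lemma acts_children g a b :
  (forall c, acts g (a ++ [:: c]) (b ++ [:: c])) -> acts g a b.
Proof. by move=> gab w; rewrite (prepend_child a) (prepend_child b) gab. Qed.

(** The sibling of a longest member [a m] is comparable to some [a j], which is no longer; a proper
    prefix of the sibling would be a prefix of [a m] too, so [a j] is the sibling. *)
Lemma partition_caret n (a : 'I_n -> address) i : cone_partition a ->
  a i <> [::] -> exists d (f : bool -> 'I_n), forall c, a (f c) = d ++ [:: c].
Proof.
move=> pa ai_neq0.
case: (@arg_maxnP _ i xpredT (size \o a)) => // m _ /= m_max.
case/lastP am: (a m) => [|d c].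
  have := m_max i isT; rewrite am leqn0 => /nilP ai0.
  by case: ai_neq0.
have [j] := partition_comparable pa (d ++ [:: ~~ c]).
case/comparable_le => [|u].
  by apply: leq_trans (m_max j isT) _; rewrite am size_rcons size_cat addn1.
case/lastP: u => [|u e].
  rewrite cats0 => aj; exists d, (fun e => if e == c then m else j) => e.
  by case: eqP => [->|/eqP]; [rewrite am cats1|case: e c aj {am} => [] [] //= ->].
rewrite cats1 -rcons_cat => /rcons_inj [dE _].
have [jm|/(partition_incomp pa)] := eqVneq j m.
  by move: am; rewrite dE jm => /(congr1 size); rewrite size_rcons size_cat; lia.
by rewrite am dE -cats1 -catA /incomp prefix_prefix.
Qed.

Definition merge n (a : 'I_n.+1 -> address) (i j : 'I_n.+1) (d : address)
  (k : 'I_n) : address := if lift j k == i then d else a (lift j k).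

Lemma merge_partition n (a : 'I_n.+1 -> address) d (f : bool -> 'I_n.+1) :
  cone_partition a -> (forall c, a (f c) = d ++ [:: c]) ->
  cone_partition (merge a (f false) (f true) d).
Proof.
move=> pa af.
have f_neq : f true != f false.
  apply/eqP => eq_f; have := af true; rewrite eq_f af.
  by move/eqP; rewrite eqseq_cat // eqxx.
have [k0 k0E _] := unlift_some f_neq.
have out l c : l != f true -> l != f false -> incomp (d ++ [:: c]) (a l).
  move=> lt lf; rewrite -af; apply: partition_incomp => //; rewrite eq_sym.
  by case: c.
apply: partition_of_incomp => [w|k l kl].
  have [l [v ->]] := cone_partition_cover pa w.
  have [[c ->]|nf] := pselect (exists c, l = f c).
    exists k0, (prepend [:: c] v).
    by rewrite /merge -k0E eqxx af prepend_cat.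
  have [|k lE _] := @unlift_some _ (f true) l.
    by apply/eqP => lt; apply: nf; exists true.
  exists k, v; rewrite /merge -lE; case: eqP => // lf.
  by case: nf; exists false.
rewrite /merge; case: eqP => [kE|kf]; case: eqP => [lE|lf].
- by case/eqP: kl; apply: (@lift_inj _ (f true)); rewrite kE.
- by apply: incomp_children => c; apply: out; [rewrite eq_sym neq_lift | apply/eqP].
- rewrite incompC; apply: incomp_children => c.
  by apply: out; [rewrite eq_sym neq_lift | apply/eqP].
- by apply: partition_incomp => //; apply: contra kl => /eqP /lift_inj ->.
Qed.

Lemma swap_partition n (b : 'I_n -> address) x y l : cone_partition b ->
  acts (swap (b x) (b y)) (b l) (b (tperm x y l)).
Proof.
move=> pb; have [->|xy] := eqVneq x y.
  by rewrite tperm1 perm1 => w; rewrite /= /swap_fun /incomp prefix_refl.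
have inc := partition_incomp pb.
case: tpermP => [->|->|/eqP lx /eqP ly]; first by apply: swapl; exact: inc.
- by apply: swapr; exact: inc.
- by apply: swap_out; exact: inc.
Qed.

Section Generation.

Variable K : set thompson.
Hypothesis subK : subgroup K.
Hypothesis swapK : forall a b, incomp a b -> K (swap a b).

Lemma mem_swap a b : K (swap a b).
Proof.
have [|ab] := boolP (incomp a b); first exact: swapK.
suff -> : swap a b = 1%g by exact: mem1K.
by apply: thompson_eqP; apply/funext => w /=; rewrite /swap_fun ab.
Qed.

(** Induction on the number of cones: two swaps carry the image of a domain caret onto a range
    caret, and merging both carets leaves one cone fewer. *)
Lemma swaps_generate_partition n (a b : 'I_n -> address) (g : thompson) :
  cone_partition a -> cone_partition b -> (forall i, acts g (a i) (b i)) -> K g.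
Proof.
elim: n => [|[|n] IHn] in a b g *; move=> pa pb gab.
- by have [[]] := cone_partition_cover pa xpred0.
- have nil0 (x : 'I_1 -> address) : cone_partition x -> x ord0 = [::].
    move=> px; case: (pselect (x ord0 = [::])) => // /(partition_caret px).
    case=> d [f xf]; have := xf true; rewrite [f true]ord1 -(ord1 (f false)) xf.
    by move/eqP; rewrite eqseq_cat // eqxx.
  suff -> : g = 1%g by exact: mem1K.
  apply: thompson_eqP; apply/funext => w.
  by have := gab ord0 w; rewrite !nil0 // prepend0.
have nnil (x : 'I_n.+2 -> address) : cone_partition x -> x ord0 <> [::].
  by move=> px x0; have := @partition_incomp _ _ px ord0 ord_max isT; rewrite x0 /incomp prefix0s.
have [d [f af]] := partition_caret pa (nnil _ pa).
have [e [f' bf']] := partition_caret pb (nnil _ pb).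
have neq (x : 'I_n.+2 -> address) y h : (forall c, x (h c) = y ++ [:: c]) ->
    h true != h false.
  move=> xh; apply/eqP => eq_h; have := xh true; rewrite eq_h xh.
  by move/eqP; rewrite eqseq_cat // eqxx.
have f_neq := neq _ _ _ af; have f'_neq := neq _ _ _ bf'.
(* [t] is where the first transposition leaves [f true]; as it differs from [f' false], the second
   transposition can send it to [f' true] without disturbing [f' false]. *)
set t := tperm (f false) (f' false) (f true).
pose s := (tperm (f false) (f' false) * tperm t (f' true))%g.
have t_neq : t != f' false.
  by rewrite -[f' false](tpermL (f false)) (inj_eq perm_inj).
have sf c : s (f c) = f' c.
  by rewrite permM; case: c; [rewrite tpermL | rewrite tpermL tpermD].
pose k := (swap (b (f false)) (b (f' false)) * swap (b t) (b (f' true)))%g.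
have kb l : acts k (b l) (b (s l)).
  by rewrite permM; apply: acts_mul; exact: swap_partition.
have Kk : K k by apply: memMK => //; exact: mem_swap.
have gE : g = (g * k * k^-1)%g by rewrite mulgK.
rewrite gE; apply: memMK => //; last exact: memVK.
have ga l : acts (g * k)%g (a l) (b (s l)) by apply: acts_mul (gab l) (kb l).
have bsf c : (b \o s) (f c) = e ++ [:: c] by rewrite /= sf.
have pbs : cone_partition (b \o s).
  apply: partition_of_incomp => [w|i j ij].
    have [i [v ->]] := cone_partition_cover pb w.
    by exists (s^-1%g i), v; rewrite /= permKV.
  by apply: (partition_incomp pb); rewrite (inj_eq perm_inj).
apply: IHn (merge_partition pa af) (merge_partition pbs bsf) _ => l.
rewrite /merge; case: ifP => // _.
by apply: acts_children => c; rewrite -af -bsf; exact: ga.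
Qed.

Lemma swaps_generate : K = [set: thompson]%classic.
Proof.
apply/seteqP; split=> // g _; have [n [a [b [pa pb gab]]]] := thompsonP g.
exact: swaps_generate_partition pa pb gab.
Qed.

End Generation.

(** The bound [n] may depend on the pair: repeated use of [swap_children] writes [swap a b] as a
    product of swaps of descendants [n] levels below. *)
Lemma deep_swaps_generate (K : set thompson) : subgroup K ->
  (forall a b, incomp a b -> exists n, forall w, n <= size w ->
     K (swap (a ++ w) (b ++ w))) ->
  K = [set: thompson]%classic.
Proof.
move=> subK deepK; apply: swaps_generate => // a b ab.
have [n nK] := deepK a b ab.
suff IH m u : n - size u <= m -> K (swap (a ++ u) (b ++ u)).
  by have := IH n [::]; rewrite !cats0; apply; rewrite subn0.
elim: m u => [|m IHm] u le_m; first by apply: nK; lia.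
rewrite swap_children; last by apply: incomp_catl; apply: incomp_catr.
by apply: memMK => //; rewrite -!catA; apply: IHm; rewrite size_cat /=; lia.
Qed.

(** * Type systems and their stabilizers *)

Lemma finite_addresses M : finite_set [set a : address | size a < M]%classic.
Proof.
elim: M => [|M IHM]; first by rewrite (_ : mkset _ = set0) // -subset0.
pose consT c := [set c :: a | a in [set a : address | size a < M]]%classic.
apply: (@sub_finite_set _ _ ([set [::]] `|` (consT false `|` consT true))%classic).
  by move=> [|[] a] /= sza; [left|right; right|right; left] => //; exists a.
by rewrite !finite_setU; split=> //; split; apply: finite_image.
Qed.

Lemma finite_addresses_bound (A : set address) : finite_set A ->
  exists M, forall a, A a -> size a < M.
Proof.
case/finite_seqP => s ->; exists (\max_(a <- s) size a).+1 => a /= sa.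
by rewrite ltnS; apply: leq_bigmax_seq.
Qed.

Section TypeSystem.

Variable P : type_system.

Lemma typexx a : P a a.
Proof. by case: (type_rel_equiv P) => refl _ _; apply: refl. Qed.

Lemma type_sym a b : P a b -> P b a.
Proof. by case: (type_rel_equiv P) => _ sym _; apply: sym. Qed.

Lemma type_trans b a c : P a b -> P b c -> P a c.
Proof. by case: (type_rel_equiv P) => _ _ trans; apply: trans. Qed.

Lemma type_cat w a b : P a b -> P (a ++ w) (b ++ w).
Proof.
elim: w a b => [|c w IHw] a b ab; first by rewrite !cats0.
rewrite -!cat_rcons; apply: IHw.
by have [/(_ ab) [abf abt] _] := type_rel_children P a b; case: c.
Qed.

Lemma type_children a b :
  (forall c, P (a ++ [:: c]) (b ++ [:: c])) -> P a b.
Proof. by move=> ab; apply/type_rel_children; rewrite -!cats1. Qed.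

Lemma type_deep a b n :
  (forall w, n <= size w -> P (a ++ w) (b ++ w)) -> P a b.
Proof.
elim: n a b => [|n IHn] a b ab; first by have := ab [::] isT; rewrite !cats0.
apply: type_children => c; apply: IHn => w le_w.
by rewrite -!catA; apply: ab.
Qed.

(** Only finitely many addresses are shorter than a given bound, so a cofinite set can be traded for
    the set of all deep addresses, where [acts_deep] makes the action defined. *)
Lemma stabilizerP (g : thompson) : stabilizer P g <->
  exists M, forall a b a' b', M <= size a -> M <= size b ->
    acts g a a' -> acts g b b' -> (P a b <-> P a' b').
Proof.
split=> [[A finA [_ gA]]|[M gM]].
  have [M MA] := finite_addresses_bound finA; exists M => a b a' b' le_a le_b.
  have inA c : M <= size c -> A c.
    by move=> le_c; apply: contrapT => /MA; rewrite ltnNge le_c.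
  by apply: gA; apply: inA.
have [N gN] := acts_deep g 0.
exists [set a : address | maxn M N <= size a]%classic.
  apply: sub_finite_set (finite_addresses (maxn M N)) => a /=.
  by move/negP; rewrite -ltnNge.
rewrite /mkset; split=> [a|a b a' b']; rewrite !geq_max => /andP [le_Ma le_Na].
  by have [a' ga _] := gN a le_Na; exists a'.
by move=> /andP [le_Mb _]; apply: gM.
Qed.


Lemma stabilizer_subgroup : subgroup (stabilizer P).
Proof.
split.
  apply/mem_set/stabilizerP; exists 0 => a b a' b' _ _.
  by do 2![move/acts_uniq/(_ (fun=> erefl)) <-].
move=> f g /set_mem /stabilizerP [M fM] /set_mem /stabilizerP [N gN].
have [N' gN'] := acts_deep g^-1%g N; have [M' fM'] := acts_deep f N'.
apply/mem_set/stabilizerP; exists (maxn M M') => a b a' b'; rewrite !geq_max.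
move=> /andP [le_Ma /fM' [a1 fa le_a1]] /andP [le_Mb /fM' [b1 fb le_b1]].
have [a2 ga le_a2] := gN' _ le_a1; have [b2 gb le_b2] := gN' _ le_b1.
move=> /acts_uniq /(_ (acts_mul fa ga)) -> /acts_uniq /(_ (acts_mul fb gb)) ->.
apply: iff_trans (fM _ _ _ _ le_Ma le_Mb fa fb) _; apply: iff_sym.
(* [g^-1] is handled by applying [gN] to [a2] and [b2], which [g] sends back to [a1] and [b1]. *)
by apply: gN => //; rewrite -[g]invgK; exact: acts_inv.
Qed.

Lemma swap_type a b c : P a b -> incomp a b -> maxn (size a) (size b) <= size c ->
  exists2 c', acts (swap a b) c c' & P c c'.
Proof.
move=> Pab ab; rewrite geq_max => /andP [le_ac le_bc].
have [ac|/comparable_le /(_ le_ac) [u ->]] := boolP (incomp a c); last first.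
  by exists (b ++ u); [apply: acts_cat; exact: swapl | exact: type_cat].
have [bc|/comparable_le /(_ le_bc) [u ->]] := boolP (incomp b c); last first.
  exists (a ++ u); first by apply: acts_cat; exact: swapr.
  by apply: type_cat; exact: type_sym.
by exists c; [apply: swap_out; rewrite incompC | exact: typexx].
Qed.

Lemma swap_stabilizer a b : P a b -> incomp a b -> stabilizer P (swap a b).
Proof.
move=> Pab ab; apply/stabilizerP; exists (maxn (size a) (size b)).
move=> c d c' d' /(swap_type Pab ab) [c1 sc Pc] /(swap_type Pab ab) [d1 sd Pd].
move=> /acts_uniq /(_ sc) -> /acts_uniq /(_ sd) ->; split=> Pcd.
  exact: type_trans (type_sym Pc) (type_trans Pcd Pd).
exact: type_trans Pc (type_trans Pcd (type_sym Pd)).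
Qed.

(** Preservation can fail in either direction; passing to [g^-1] turns the creation of a relation
    into the loss of one. *)
Lemma not_stabilizer (g : thompson) m : ~ stabilizer P g ->
  exists k a b a' b', [/\ k = g \/ k = g^-1%g, acts k a a', acts k b b',
    P a b /\ ~ P a' b' & all (fun c => m <= size c) [:: a; b; a'; b']].
Proof.
move=> gP; have [M gM] := acts_deep g m; apply: contrapT => no_k; apply: gP.
apply/stabilizerP; exists (maxn m M) => a b a' b'; rewrite !geq_max.
move=> /andP [le_a /gM [a1 ga le_a1]] /andP [le_b /gM [b1 gb le_b1]].
move=> /acts_uniq /(_ ga) -> /acts_uniq /(_ gb) ->.
split=> Pab; apply: contrapT => nPab; apply: no_k.
  by exists g, a, b, a1, b1; split; [left| | | |rewrite /= le_a le_b le_a1 le_b1].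
exists (g^-1)%g, a1, b1, a, b; split; [by right | exact: acts_inv | | |].
- exact: acts_inv.
- by [].
- by rewrite /= le_a le_b le_a1 le_b1.
Qed.

Lemma types_eq (Q : type_system) : types Q = types P -> forall a b, Q a b <-> P a b.
Proof.
move=> QP a b; have : types P [set b | P a b]%classic by exists a.
rewrite -QP => -[c _ /seteqP [QsubP PsubQ]].
have Qca : Q c a by apply: PsubQ; exact: typexx.
case: (type_rel_equiv Q) => _ sym trans; split=> [Qab|/PsubQ Qcb].
  by apply: QsubP; apply: trans Qca Qab.
exact: trans (sym _ _ Qca) Qcb.
Qed.

Section Finite.

Hypothesis finP : finite_type_system P.

(* A bound depending on an address only through its type may be chosen
   independently of the address. *)
Lemma uniform_bound (F : address -> nat -> Prop) :
  (forall a b m, P a b -> F a m -> F b m) ->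
  (forall a m n, m <= n -> F a m -> F a n) ->
  (forall a, exists m, F a m) -> exists m, forall a, F a m.
Proof.
move=> F_type F_mono F_ex; have /finite_seqP [s typesE] := finP.
suff [m mF] : exists m, forall a, [set b | P a b]%classic \in s -> F a m.
  exists m => a; apply: mF.
  have : types P [set b | P a b]%classic by exists a.
  by rewrite typesE.
elim: s {typesE} => [|C s [m mF]]; first by exists 0.
have [[a aC]|noC] := pselect (exists a, [set b | P a b]%classic = C); last first.
  exists m => a; rewrite inE => /orP [/eqP aC|/mF //].
  by case: noC; exists a.
have [n aF] := F_ex a; exists (maxn m n) => b; rewrite inE => /orP [/eqP bC|/mF].
  apply: F_mono (leq_maxr m n) _; apply: F_type aF.
  have : [set c | P b c]%classic b by exact: typexx.
  by rewrite bC -aC.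
exact: F_mono (leq_maxl m n).
Qed.

End Finite.

Section Simple.

Hypothesis simpleP : simple_type_system P.

Lemma simple_not_universal : ~ universal P.
Proof. by move=> /simpleP [_]; apply. Qed.

Lemma deep_types_differ n : exists a b,
  [/\ n <= size a, n <= size b & ~ P a b].
Proof.
apply: contrapT => no_ab; apply: simple_not_universal => a b.
apply: (@type_deep _ _ n) => w le_w; apply: contrapT => ab; apply: no_ab.
by exists (a ++ w), (b ++ w); split; rewrite ?size_cat //; lia.
Qed.

(* Being eventually related by E defines a quotient of P. *)
Lemma simple_dichotomy (E : address -> address -> Prop) :
  RelationClasses.Equivalence E -> (forall a b, P a b -> E a b) ->
  (forall a b c, E a b -> E (a ++ [:: c]) (b ++ [:: c])) ->
  (forall a b, E a b -> P a b) \/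
  (forall a b, exists n, forall w, n <= size w -> E (a ++ w) (b ++ w)).
Proof.
move=> [Erefl Esym Etrans] PE E_child.
pose R a b := exists n, forall w, n <= size w -> E (a ++ w) (b ++ w).
have E_cat w a b : E a b -> E (a ++ w) (b ++ w).
  elim: w a b => [|c w IHw] a b ab; first by rewrite !cats0.
  by rewrite -!cat_rcons -!cats1; apply/IHw/E_child.
have ER a b : E a b -> R a b by move=> ab; exists 0 => w _; exact: E_cat.
have Requiv : RelationClasses.Equivalence R.
  split=> [a|a b [n ab]|a b c [m ab] [n bc]]; first exact/ER/Erefl.
  - by exists n => w /ab; apply: Esym.
  - exists (maxn m n) => w; rewrite geq_max => /andP [/ab + /bc].
    exact: Etrans.
have Rchildren a b : R a b <->
    R (rcons a false) (rcons b false) /\ R (rcons a true) (rcons b true).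
  split=> [[n ab]|[[m abf] [n abt]]].
    by split; exists n => w le_w; rewrite !cat_rcons; apply: ab => /=; exact: leqW.
  exists (maxn m n).+1 => -[//|c w]; rewrite /= ltnS geq_max.
  by move=> /andP [/abf + /abt]; rewrite !cat_rcons; case: c.
pose Q := TypeSystem Requiv Rchildren.
have [/types_eq QP|QP] := pselect (types Q = types P).
  by left=> a b /ER /QP.
right; apply: (iffLR (simpleP Q)); split=> // a b Pab.
exact/ER/PE.
Qed.

End Simple.

End TypeSystem.

(** * Roomy addresses *)

Section Room.

Variable P : type_system.

Definition roomy (a : address) : Prop :=
  exists v w, [/\ incomp v w, P (a ++ v) a & P (a ++ w) a].

Lemma roomy_type a b : P a b -> roomy a -> roomy b.
Proof.
move=> Pab [v [w [vw av aw]]]; have Pba := type_sym Pab.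
by exists v, w; split=> //; apply: type_trans (type_cat _ Pba) (type_trans _ Pab).
Qed.

(** The members of [L] are avoided one at a time: a long [l] comparable to [s ++ v] extends it and
    so misses [s ++ w]. The new base has the type of [s], so [v] and [w] recur there again, and it
    is longer by at most [size v + size w]. *)
Lemma room_antichain v w s L : incomp v w -> P (s ++ v) s -> P (s ++ w) s ->
  all (fun l => size s + size L * (size v + size w) <= size l) L ->
  exists2 u, P (s ++ u) s & all (incomp (s ++ u)) L.
Proof.
move=> vw; elim: L s => [|l L IHL] s sv sw.
  by exists [::]; rewrite ?cats0 //; exact: typexx.
move=> /= /andP [le_l le_L].
have [x [sx le_x xl]] : exists x, [/\ P (s ++ x) s, size x <= size v + size w &
    incomp (s ++ x) l].
  have [vl|/comparable_le[|x lE]] := boolP (incomp (s ++ v) l).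
  - by exists v; rewrite leq_addr.
  - by rewrite size_cat; lia.
  exists w; split=> //; first exact: leq_addl.
  by rewrite lE incompC; apply: incomp_catl; rewrite incomp_cat2l.
have ssx := type_sym sx.
have [||| u xu uL] := IHL (s ++ x).
- exact: type_trans (type_cat _ sx) (type_trans sv ssx).
- exact: type_trans (type_cat _ sx) (type_trans sw ssx).
- by apply: sub_all le_L => m; rewrite size_cat; apply: leq_trans; nia.
exists (x ++ u); first by rewrite catA; apply: type_trans xu sx.
by rewrite /= catA uL andbT; apply: incomp_catl.
Qed.

(* Five is the largest number of addresses ever to be avoided simultaneously, in
   [swappableP]. *)
Definition room (s : address) (m : nat) : Prop :=
  forall L M, size L <= 5 -> all (fun l => m <= size l) L ->
  exists g, [/\ P s g, M <= size g & all (incomp g) L].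

(** Once away from [L], appending the nonempty word [v] again and again adds depth and keeps the
    type. *)
Lemma roomy_room s : roomy s -> exists m, room s m.
Proof.
move=> [v [w [vw sv sw]]].
have v_gt0 : 0 < size v.
  by rewrite lt0n; apply: contraL vw => /nilP ->; rewrite /incomp prefix0s.
exists (size s + 5 * (size v + size w)) => L M le_L all_L.
have [|u su uL] := room_antichain (s := s) (L := L) vw sv sw.
  by apply: sub_all all_L => l; apply: leq_trans; rewrite leq_add2l leq_mul2r le_L orbT.
elim: M => [|M [g [sg le_g gL]]].
  by exists (s ++ u); split=> //; exact: type_sym.
exists (g ++ v); split.
- exact: type_trans (type_sym sv) (type_cat v sg).
- by rewrite size_cat; lia.
- by apply: sub_all gL => l; exact: incomp_catl.
Qed.

Hypothesis finP : finite_type_system P.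

Lemma uniform_room : exists m, forall s, roomy s -> room s m.
Proof.
apply: (uniform_bound finP (F := fun s m => roomy s -> room s m)).
- move=> a b m Pab am /(roomy_type (type_sym Pab)) /am bm L M le_L all_L.
  have [g [ag le_g gL]] := bm L M le_L all_L.
  by exists g; split=> //; exact: type_trans (type_sym Pab) ag.
- move=> a m n le_mn am /am {}am L M le_L all_L; apply: am => //.
  by apply: sub_all all_L => l; exact: leq_trans.
- move=> a; have [/roomy_room [m am]|nr] := pselect (roomy a).
    by exists m.
  by exists 0.
Qed.


(* If the swap of a and b preserved types eventually, an address of the type of
   b ++ w away from both, being fixed, would force P (a ++ w) (b ++ w). *)
Lemma swap_not_stabilizer m a b : (forall s, roomy s -> room s m) ->
  m <= size a -> m <= size b -> incomp a b -> (forall w, roomy (b ++ w)) ->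
  ~ P a b -> ~ stabilizer P (swap a b).
Proof.
move=> rm le_a le_b ab rb nPab /stabilizerP [M sM]; apply: nPab.
apply: (type_deep (n := M)) => w le_w.
have [||g [bg le_g /and3P [ga gb _]]] := rm _ (rb w) [:: a; b] M.
- by [].
- by rewrite /= le_a le_b.
have [] := sM g (b ++ w) g (a ++ w).
- by [].
- by rewrite size_cat; lia.
- exact: swap_out.
- by apply: acts_cat; exact: swapr.
by move=> /(_ (type_sym bg)) ga' _; apply: type_sym; apply: type_trans bg ga'.
Qed.

Section Overgroup.

Variable K : set thompson.
Hypotheses (subK : subgroup K) (HK : (stabilizer P `<=` K)%classic).

Lemma conjK (k : thompson) a b a' b' : K k -> incomp a b -> acts k a a' ->
  acts k b b' -> K (swap a b) -> K (swap a' b').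
Proof.
move=> Kk ab ka kb Kab; rewrite (swap_conj ab ka kb).
by do 2![apply: memMK => //]; apply: memVK.
Qed.

Lemma swap_move a b c : P b c -> incomp a b -> incomp b c -> incomp a c ->
  K (swap a b) -> K (swap a c).
Proof.
move=> Pbc ab bc ac; apply: (@conjK (swap b c)) => //.
- by apply: HK; exact: swap_stabilizer.
- exact: swap_out.
- exact: swapl.
Qed.

Lemma swap_movel a b c : P a c -> incomp a b -> incomp a c -> incomp c b ->
  K (swap a b) -> K (swap c b).
Proof.
move=> Pac ab ac cb; rewrite !(swapC _ b); apply: swap_move => //.
  by rewrite incompC.
by rewrite incompC.
Qed.

Lemma swap_trans a b c : incomp a b -> incomp b c -> incomp a c ->
  K (swap a b) -> K (swap b c) -> K (swap a c).
Proof.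
move=> ab bc ac Kab Kbc; by apply: conjK Kbc ab (swap_out ab ac) (swapl bc) Kab.
Qed.

(** * The case in which all deep addresses are roomy *)

Section AllRoomy.

Variable m : nat.
Hypothesis (deep_roomy : forall a, m <= size a -> roomy a).
Hypothesis (roomP : forall s, roomy s -> room s m).

Lemma deep_room a M L : m <= size a -> size L <= 5 ->
  all (fun l => m <= size l) L ->
  exists g, [/\ P a g, M <= size g & all (incomp g) L].
Proof. by move=> le_a; apply: (roomP (deep_roomy le_a)). Qed.

(** One deep witness pair is asked for; [swappableP] passes from it to all deep incomparable pairs
    of these types. *)
Definition swappable a b : Prop := exists a' b',
  [/\ P a a', P b b', m <= size a' /\ m <= size b', incomp a' b' & K (swap a' b')].

(** The witness pair may overlap the target pair, so [g] and [d], away from all four addresses and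
    from each other, serve as intermediates. One member changes at a time: from [a1, b1] to [g, b1],
    [g, d], [a', d] and [a', b']. *)
Lemma swappableP a b a' b' : swappable a b -> P a a' -> P b b' ->
  m <= size a' -> m <= size b' -> incomp a' b' -> K (swap a' b').
Proof.
move=> [a1 [b1 [Pa1 Pb1 [le_a1 le_b1] ab1 K1]]] Pa Pb le_a le_b ab.
have [||g [Pg le_g]] := @deep_room a1 m [:: a1; b1; a'; b'] le_a1.
- by [].
- by rewrite /= le_a1 le_b1 le_a le_b.
move=> /and5P [ga1 gb1 ga gb _].
have [||d [Pd le_d]] := @deep_room b1 m [:: g; a1; b1; a'; b'] le_b1.
- by [].
- by rewrite /= le_g le_a1 le_b1 le_a le_b.
move=> /= /and5P [dg da1 db1 da /andP [db _]].
have Pag : P a g by exact: type_trans Pg.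
have Pbd : P b d by exact: type_trans Pd.
have sym x y : incomp x y -> incomp y x by rewrite incompC.
have [ag bg ag' bg'] := And4 (sym _ _ ga1) (sym _ _ gb1) (sym _ _ ga) (sym _ _ gb).
have [bd ad' bd'] := And3 (sym _ _ db1) (sym _ _ da) (sym _ _ db).

have K2 : K (swap g b1) by apply: swap_movel K1.
have gd := sym _ _ dg.
have K3 : K (swap g d) by apply: swap_move K2.
have Pga' : P g a' by exact: type_trans (type_sym Pag) Pa.
have K4 : K (swap a' d) by apply: swap_movel K3.
have Pdb' : P d b' by exact: type_trans (type_sym Pbd) Pb.
exact: swap_move K4.
Qed.

Lemma swappable_type a b : m <= size a -> P a b -> swappable a b.
Proof.
move=> le_a Pab; have [||g [Pg le_g /= /andP [ga _]]] := @deep_room a m [:: a] le_a.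
- by [].
- by rewrite /= le_a.
rewrite incompC in ga.
exists a, g; split=> //; first exact: typexx.
- exact: type_trans (type_sym Pab) Pg.
- by apply: HK; exact: swap_stabilizer.
Qed.

Lemma swappable_sym a b : swappable a b -> swappable b a.
Proof.
move=> [a' [b' [Pa Pb [le_a le_b] ab Kab]]].
by exists b', a'; split=> //; [rewrite incompC | rewrite swapC].
Qed.

Lemma swappable_trans a b c : m <= size a -> m <= size b -> m <= size c ->
  swappable a b -> swappable b c -> swappable a c.
Proof.
move=> le_a le_b le_c Qab Qbc.
have [||b' [Pb le_b' /= /andP [ba _]]] := @deep_room b m [:: a] le_b.
- by [].
- by rewrite /= le_a.
have [||c' [Pc le_c' /= /and3P [ca cb _]]] := @deep_room c m [:: a; b'] le_c.
- by [].
- by rewrite /= le_a le_b'.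
rewrite incompC in ba; rewrite incompC in ca; rewrite incompC in cb.
exists a, c'; split=> //; first exact: typexx.
apply: (@swap_trans a b') => //.
- by apply: (swappableP Qab) => //; exact: typexx.
- exact: (swappableP Qbc).
Qed.

(** The stabilizer swaps [a' ++ w] with some [g] of its type away from [a'] and [b']; conjugation by
    [swap a' b'] yields the swap of [b' ++ w] and [g]. *)
Lemma swappable_cat w a b : swappable a b -> swappable (a ++ w) (b ++ w).
Proof.
move=> [a' [b' [Pa Pb [le_a le_b] ab Kab]]].
have le_aw : m <= size (a' ++ w) by rewrite size_cat; lia.
have le_bw : m <= size (b' ++ w) by rewrite size_cat; lia.
have [||g [Pg le_g /= /and3P [ga gb _]]] := @deep_room (a' ++ w) m [:: a'; b'] le_aw.
- by [].
- by rewrite /= le_a le_b.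
have ag : incomp a' g by rewrite incompC.
have bg : incomp b' g by rewrite incompC.
have awg : incomp (a' ++ w) g by exact: incomp_catl.
have bwg : incomp (b' ++ w) g by exact: incomp_catl.
apply: swappable_sym; exists (b' ++ w), g; split=> //.
- exact: type_cat.
- exact: type_trans (type_cat w Pa) Pg.
- apply: (@conjK (swap a' b') (a' ++ w) g) => //.
  + by apply: acts_cat; exact: swapl.
  + exact: swap_out.
  + by apply: HK; exact: swap_stabilizer.
Qed.

Lemma all_roomy_generate : simple_type_system P ->
  (exists a b, [/\ m <= size a, m <= size b, incomp a b, ~ P a b & K (swap a b)]) ->
  K = [set: thompson]%classic.
Proof.
move=> simpleP [a [b [le_a le_b ab nPab Kab]]].
(* Prolonging by at least [m] letters makes [E] reflexive and transitive on all addresses, short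
   ones included. *)
pose E c d := forall w, m <= size w -> swappable (c ++ w) (d ++ w).
have deep c w : m <= size w -> m <= size (c ++ w) by rewrite size_cat; lia.
have Eequiv : RelationClasses.Equivalence E.
  split=> [c w le_w|c d cd w le_w|c d e cd de w le_w].
  - by apply: swappable_type; [exact: deep | exact: typexx].
  - by apply: swappable_sym; exact: cd.
  - by apply: (@swappable_trans _ (d ++ w)); auto.
have [||EP|univ] := @simple_dichotomy P simpleP E Eequiv.
- by move=> c d Pcd w le_w; apply: swappable_type; [exact: deep | exact: type_cat].
- by move=> c d e cd w le_w; rewrite -!catA; apply: cd; rewrite /= leqW.
- case: nPab; apply: EP => w _; apply: swappable_cat.
  by exists a, b; split=> //; exact: typexx.
apply: deep_swaps_generate => // c d cd; have [n cdn] := univ c d.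
(* The first [n] letters of [w] bring the pair into [E]; the others supply the [m] letters that [E]
   demands. *)
exists (n + m) => w le_w.
have le_d : m <= size (drop n w) by rewrite size_drop; lia.
have le_t : n <= size (take n w) by rewrite size_takel //; lia.
have := cdn _ le_t _ le_d; rewrite -!catA cat_take_drop => /swappableP; apply.
- exact: typexx.
- exact: typexx.
- by apply: deep; lia.
- by apply: deep; lia.
- by apply: incomp_catl; apply: incomp_catr.
Qed.

End AllRoomy.
End Overgroup.
End Room.

(** * Constant addresses *)

Section Constant.

Variable P : type_system.

Definition constant (a : address) : Prop := forall w, P (a ++ w) a.

Lemma constant_type a b : P a b -> constant a -> constant b.
Proof.
move=> Pab ca w; apply: type_trans (type_cat w (type_sym Pab)) _.
exact: type_trans (ca w) Pab.
Qed.

Lemma constant_cat w a : constant a -> constant (a ++ w).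
Proof.
by move=> ca v; rewrite -catA; apply: type_trans (ca _) (type_sym (ca _)).
Qed.

Lemma constant_roomy a : constant a -> roomy P a.
Proof. by move=> ca; exists [:: false], [:: true]. Qed.

(** The children of [a ++ [:: false]] are related to the corresponding children of [a], so [a] has
    the type of this constant address. *)
Lemma constant_children a : (forall c, constant (a ++ [:: c])) ->
  P (a ++ [:: false]) (a ++ [:: true]) -> constant a.
Proof.
move=> ca aft; have child c d : P (a ++ [:: c]) (a ++ [:: d]).
  case: c d => [] [] //; [exact: typexx|exact: type_sym|exact: typexx].
suff Pa : P (a ++ [:: false]) a by apply: constant_type Pa (ca _).
apply: type_children => c.
exact: type_trans (ca false [:: c]) (child _ _).
Qed.

Hypotheses (finP : finite_type_system P) (simpleP : simple_type_system P).

(** Glue all of [C] into one class: by [simple_dichotomy] either this adds nothing to [P], or every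
    deep [b] becomes related to [a0 ++ b], which lies in [C]. *)
Lemma closed_dichotomy (C : address -> Prop) a0 :
  (forall a b, P a b -> C a -> C b) -> (forall a c, C a -> C (a ++ [:: c])) ->
  C a0 ->
  (forall a b, C a -> C b -> P a b) \/ exists n, forall b, n <= size b -> C b.
Proof.
move=> C_type C_child Ca0; pose E a b := P a b \/ C a /\ C b.
have C_cat w a : C a -> C (a ++ w).
  elim: w a => [|c w IHw] a Ca; first by rewrite cats0.
  by rewrite -cat_rcons -cats1; apply/IHw/C_child.
have Eequiv : RelationClasses.Equivalence E.
  split=> [a|a b [ab|[Ca Cb]]|a b c].
  - by left; exact: typexx.
  - by left; exact: type_sym.
  - by right.
  - move=> [ab|[Ca Cb]] [bc|[Cb' Cc]].
    + by left; exact: type_trans bc.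
    + by right; split=> //; apply: C_type Cb'; exact: type_sym.
    + by right; split=> //; apply: C_type Cb.
    + by right.
have [||EP|univ] := simple_dichotomy simpleP Eequiv.
- by left.
- move=> a b c [ab|[Ca Cb]]; [by left; exact: type_cat|by right; split; exact: C_child].
- by left=> a b Ca Cb; apply: EP; right.
right; have [n nE] := univ [::] a0; exists n => b /nE [ba|[]] //.
by apply: C_type (type_sym ba) _; exact: C_cat.
Qed.

(** The types occurring below [a] form a closed family, and if they were all equal, [a] would be
    constant. Finiteness makes the bound uniform. *)
Lemma nonconstant_reach : exists n, forall a, ~ constant a ->
  forall b, n <= size b -> exists w, P (a ++ w) b.
Proof.
apply: (uniform_bound finP
  (F := fun a n => ~ constant a -> forall b, n <= size b -> exists w, P (a ++ w) b)).
- move=> a b n Pab an nb c le_c; have [|w awc] := an _ c le_c.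
    by move/(constant_type Pab).
  by exists w; apply: type_trans awc; apply: type_cat; exact: type_sym.
- by move=> a m n le_mn am na b le_b; apply: am => //; exact: leq_trans le_b.
move=> a; have [ca|na] := pselect (constant a); first by exists 0.
have [|||all_eq|[n nC]] := @closed_dichotomy (fun b => exists w, P (a ++ w) b) a.
- by move=> b c bc [w aw]; exists w; exact: type_trans bc.
- by move=> b c [w aw]; exists (w ++ [:: c]); rewrite catA; exact: type_cat.
- by exists [::]; rewrite cats0; exact: typexx.
- case: na => w; apply: all_eq.
    by exists w; exact: typexx.
  by exists [::]; rewrite cats0; exact: typexx.
by exists n.
Qed.

(** * The case of arbitrarily deep addresses that are not roomy *)

Section NotAllRoomy.

Hypothesis not_roomy : forall n, exists2 a, n <= size a & ~ roomy P a.

(** The addresses of the types of [a] and [b] form a closed family. It cannot contain all deep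
    addresses, since its members are constant and hence roomy. *)
Lemma constant_eq a b : constant a -> constant b -> P a b.
Proof.
move=> ca cb.
have [|||all_eq|[n nC]] := @closed_dichotomy (fun c => P a c \/ P b c) a.
- by move=> c d cd [ac|bc]; [left|right]; exact: type_trans cd.
- move=> c d [ac|bc]; [left|right]; apply: type_trans (type_cat _ _).
  + exact: (type_sym (ca [:: d])).
  + by [].
  + exact: (type_sym (cb [:: d])).
  + by [].
- by left; exact: typexx.
- by apply: all_eq; [left|right]; exact: typexx.
have [c /nC Cc []] := not_roomy n.
by case: Cc => [/constant_type /(_ ca)|/constant_type /(_ cb)] /constant_roomy.
Qed.

(** Two constant children would have the same type and make [a] constant. If both were nonconstant,
    a deep [b] that is not roomy would reach the type of [a] and from there, through either child,
    its own type again, which makes it roomy. *)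
Lemma nonconstant_child : exists n, forall a, n <= size a -> ~ constant a ->
  exists2 c, ~ constant (a ++ [:: c]) & constant (a ++ [:: ~~ c]).
Proof.
have [n reach] := nonconstant_reach; exists n => a le_a na.
have [b le_b nrb] := not_roomy n; have [w awb] := reach a na b le_b.
have nb : ~ constant b by move/constant_roomy.
have [v bva] := reach b nb a le_a.
have [[c nc]|all_c] := pselect (exists c, ~ constant (a ++ [:: c])); last first.
  have ca c : constant (a ++ [:: c]) by apply: contrapT => nc; apply: all_c; exists c.
  by case: na; apply: constant_children => //; exact: constant_eq.
exists c => //; apply: contrapT => nc'; apply: nrb.
have back d : ~ constant (a ++ [:: d]) -> exists x, P (b ++ v ++ d :: x) b.
  move=> /reach /(_ _ le_b) [x adx]; exists x; apply: type_trans adx.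
  by rewrite -cat1s !catA -catA -[X in P _ X]catA; exact: type_cat.
have [[x bx] [y bY]] := (back _ nc, back _ nc').
exists (v ++ c :: x), (v ++ ~~ c :: y); split=> //.
by rewrite incomp_cat2l /incomp; case: (c).
Qed.

Section Overgroup.

Variable m : nat.
Hypothesis child : forall a, m <= size a -> ~ constant a ->
  exists2 c, ~ constant (a ++ [:: c]) & constant (a ++ [:: ~~ c]).
Hypothesis reach : forall a, ~ constant a ->
  forall b, m <= size b -> exists w, P (a ++ w) b.
Hypothesis roomP : forall s, roomy P s -> room P s m.

Lemma nonconstant_deep a n : m <= size a -> ~ constant a ->
  exists2 w, size w = n & ~ constant (a ++ w).
Proof.
move=> le_a na; elim: n => [|n [w <- nw]]; first by exists [::]; rewrite ?cats0.
have [|c nc _] := child _ nw; first by rewrite size_cat; lia.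
by exists (w ++ [:: c]); rewrite ?size_cat ?addn1 // catA.
Qed.

Lemma constant_extension a : m <= size a -> exists w, constant (a ++ w).
Proof.
move=> le_a; have [ca|/(child le_a) [c _ cc]] := pselect (constant a).
  by exists [::]; rewrite cats0.
by exists [:: ~~ c].
Qed.

Lemma constant_away L M : size L <= 5 -> all (fun l => m <= size l) L ->
  exists g, [/\ constant g, M <= size g & all (incomp g) L].
Proof.
move=> le_L all_L; have [a le_a _] := not_roomy m.
have [w cw] := constant_extension le_a.
have [g [awg le_g gL]] := roomP (constant_roomy cw) M le_L all_L.
by exists g; split=> //; exact: constant_type cw.
Qed.

(** [E] compares the positions of constant descendants. It cannot become universal eventually: a
    nonconstant [c] has nonconstant descendants at every depth, while those of some [c ++ e] are all
    constant. *)
Lemma type_of_constants a b :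
  (forall w, constant (a ++ w) <-> constant (b ++ w)) -> P a b.
Proof.
pose E a b := forall w, constant (a ++ w) <-> constant (b ++ w).
have Eequiv : RelationClasses.Equivalence E.
  by split=> [c w|c d cd w|c d e cd de w]; [|apply: iff_sym|apply: iff_trans (cd w) _].
have [||EP|univ] := simple_dichotomy simpleP Eequiv; last 2 first.
- exact: EP.
- have [c le_c nrc] := not_roomy m.
  have nc : ~ constant c by move/constant_roomy.
  have [e ce] := constant_extension le_c.
  have [n nE] := univ c (c ++ e); have [w szw ncw] := nonconstant_deep n le_c nc.
  case: ncw; have := nE w; rewrite szw => /(_ (leqnn n)) /(_ [::]).
  by rewrite !cats0 => /iffRL; apply; exact: constant_cat.
- by move=> c d cd w; split; apply: constant_type; apply: type_cat => //; exact: type_sym.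
- by move=> c d e cd w; rewrite -!catA; exact: cd.
Qed.

Variable K : set thompson.
Hypotheses (subK : subgroup K) (HK : (stabilizer P `<=` K)%classic).

Definition absorbs (d : address) : Prop := forall e, constant e -> m <= size e ->
  incomp d e -> K (swap d e).

(** Constant addresses all have the same type. As [e] and [f] may be comparable, the passage from
    one to the other goes through a third, [g]. *)
Lemma absorbs_swap d e : m <= size d -> m <= size e -> constant e -> incomp d e ->
  K (swap d e) -> absorbs d.
Proof.
move=> le_d le_e ce de Kde f cf le_f df.
have [||g [cg le_g /= /and4P []]] := @constant_away [:: d; e; f] m.
- by [].
- by rewrite /= le_d le_e le_f.
rewrite !(incompC g) => dg eg fg _; apply: (@swap_move _ _ subK HK d g) => //.
- exact: constant_eq.
- by rewrite incompC.
by apply: (@swap_move _ _ subK HK d e) => //; exact: constant_eq.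
Qed.

Lemma swap_child d e c : incomp d e ->
  K (swap (d ++ [:: ~~ c]) (e ++ [:: ~~ c])) ->
  K (swap d e) <-> K (swap (d ++ [:: c]) (e ++ [:: c])).
Proof.
move=> /swap_children ->; case: c => Kc; split=> Kd.
- by rewrite -[swap _ _](mulKg (swap (d ++ [:: false]) (e ++ [:: false])));
    apply: memMK => //; exact: memVK.
- exact: memMK.
- by rewrite -[swap _ _](mulgK (swap (d ++ [:: true]) (e ++ [:: true])));
    apply: memMK => //; exact: memVK.
- exact: memMK.
Qed.

(** For constant [e], the addresses [d ++ [:: ~~ c]] and [e ++ [:: ~~ c]] are both constant, so
    their swap lies in [K] and the other factor of [swap d e] decides. *)
Lemma absorbs_child d c : m <= size d -> constant (d ++ [:: ~~ c]) ->
  absorbs d <-> absorbs (d ++ [:: c]).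
Proof.
move=> le_d cd.
have [||e [ce le_e /= /andP []]] := @constant_away [:: d] m.
- by [].
- by rewrite /= le_d.
rewrite incompC => de _.
have inc b : incomp (d ++ [:: b]) (e ++ [:: b]).
  by apply: incomp_catl; apply: incomp_catr.
have Kc : K (swap (d ++ [:: ~~ c]) (e ++ [:: ~~ c])).
  by apply/HK/swap_stabilizer => //; apply: constant_eq => //; exact: constant_cat.
have le_child (x : address) b : m <= size x -> m <= size (x ++ [:: b]).
  by rewrite size_cat; lia.
have := swap_child de Kc; split=> [Ad|Adc].
  apply: (@absorbs_swap _ (e ++ [:: c])); rewrite ?le_child //.
    exact: constant_cat.
  by rewrite -swap_child //; exact: Ad.
apply: (absorbs_swap le_d le_e) => //; rewrite (@swap_child _ _ c) //.
by apply: Adc => //; [exact: constant_cat | exact: le_child].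
Qed.

Lemma absorbs_descendant d w : m <= size d -> ~ constant (d ++ w) ->
  absorbs d <-> absorbs (d ++ w).
Proof.
move=> le_d; elim/last_ind: w => [|w c IHw]; first by rewrite cats0.
rewrite -cats1 catA => nwc.
have nw : ~ constant (d ++ w) by move/(constant_cat [:: c]).
have le_dw : m <= size (d ++ w) by rewrite size_cat; lia.
apply: iff_trans (IHw nw) _; have [b nb cb] := child le_dw nw.
apply: absorbs_child => //.
by case: b c cb nwc {nb} => [] [].
Qed.

Lemma absorbs_type d d' : m <= size d -> m <= size d' -> P d d' -> incomp d d' ->
  absorbs d -> absorbs d'.
Proof.
move=> le_d le_d' Pdd' dd' Ad.
have [||e [ce le_e /= /and3P []]] := @constant_away [:: d; d'] m.
- by [].
- by rewrite /= le_d le_d'.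
rewrite !(incompC e) => de d'e _; apply: (absorbs_swap le_d' le_e) => //.
by apply: (swap_movel subK HK Pdd') => //; exact: Ad.
Qed.

(** Go down from [d] to an address of the type of [d'], then across by [absorbs_type]; if these two
    are comparable, move along the path joining them instead. *)
Lemma absorbs_all d d' : m <= size d -> m <= size d' -> ~ constant d ->
  ~ constant d' -> absorbs d -> absorbs d'.
Proof.
move=> le_d le_d' nd nd' Ad; have [w Pdw] := reach nd le_d'.
have nw : ~ constant (d ++ w) by move/(constant_type Pdw).
have le_dw : m <= size (d ++ w) by rewrite size_cat; lia.
have {Ad} Adw : absorbs (d ++ w) by rewrite -absorbs_descendant.
have [inc|cmp] := boolP (incomp (d ++ w) d'); first exact: absorbs_type Adw.
have [le_size|/ltnW le_size] := leqP (size (d ++ w)) (size d').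
  have [u uE] := comparable_le cmp le_size.
  by rewrite uE -absorbs_descendant -?uE.
rewrite incompC in cmp; have [u uE] := comparable_le cmp le_size.
by rewrite (@absorbs_descendant _ u) -?uE.
Qed.

(** Two constant addresses are swapped by the stabilizer, a mixed pair by absorption, and two
    nonconstant ones through a constant address away from both. *)
Lemma absorbs_generate d : m <= size d -> ~ constant d -> absorbs d ->
  K = [set: thompson]%classic.
Proof.
move=> le_d nd Ad; apply: deep_swaps_generate => // a b ab; exists m => w le_w.
have : m <= size (a ++ w) by rewrite size_cat; lia.
have : m <= size (b ++ w) by rewrite size_cat; lia.
have : incomp (a ++ w) (b ++ w) by apply: incomp_catl; apply: incomp_catr.
move: (a ++ w) (b ++ w) => {w le_w ab} {}a {}b ab le_b le_a.
have A x : m <= size x -> ~ constant x -> absorbs x by move=> *; apply: absorbs_all Ad.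
have [ca|na] := pselect (constant a); have [cb|nb] := pselect (constant b).
- by apply/HK/swap_stabilizer => //; exact: constant_eq.
- by rewrite swapC; apply: A => //; rewrite incompC.
- exact: A.
have [||e [ce le_e /= /and3P []]] := @constant_away [:: a; b] m.
- by [].
- by rewrite /= le_a le_b.
move=> ea eb _; apply: (@swap_trans _ subK a e b) => //.
- by rewrite incompC.
- by apply: A => //; rewrite incompC.
- by rewrite swapC; apply: A => //; rewrite incompC.
Qed.

Lemma constant_to_nonconstant_generate k a a' : K k -> acts k a a' ->
  m <= size a -> m <= size a' -> constant a -> ~ constant a' ->
  K = [set: thompson]%classic.
Proof.
move=> Kk ka le_a le_a' ca na'; have [M kM] := acts_deep k m.
have [||e [ce le_e /= /andP []]] := @constant_away [:: a] M.
- by [].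
- by rewrite /= le_a.
rewrite incompC => ae _; have [e' ke le_e'] := kM e le_e.
(* [e'] may be nonconstant; some [w] makes [e' ++ w] constant, and [e ++ w] stays so. *)
have [w cw] := constant_extension le_e'.
have aew := incomp_catr w ae; have kew := acts_cat w ke.
apply: (absorbs_generate le_a' na').
apply: (@absorbs_swap _ (e' ++ w)) => //; first by rewrite size_cat; lia.
  exact: acts_incomp aew.
apply: (conjK subK Kk aew ka kew); apply/HK/swap_stabilizer => //.
by apply: constant_eq => //; exact: constant_cat.
Qed.

(** If [k] breaks the relation of [a] and [b], some [w] makes exactly one of [a' ++ w] and [b' ++ w]
    constant, whereas [a ++ w] and [b ++ w] agree. So [k] or its inverse takes a constant address to
    a nonconstant one. *)
Lemma not_all_roomy_generate g : K g -> ~ stabilizer P g ->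
  K = [set: thompson]%classic.
Proof.
move=> Kg /(not_stabilizer m) [k [a [b [a' [b' []]]]]].
move=> kE ka kb [Pab nPab] /and5P [le_a le_b le_a' le_b' _].
have Kk : K k by case: kE => ->; last exact: memVK.
have size_le (x w : address) : m <= size x -> m <= size (x ++ w).
  by rewrite size_cat; lia.
have [w nw] : exists w, ~ (constant (a' ++ w) <-> constant (b' ++ w)).
  apply: contrapT => no_w; apply/nPab/type_of_constants => w.
  by apply: contrapT => nw; apply: no_w; exists w.
have {ka kb} [ka kb] := (acts_cat w ka, acts_cat w kb).
have cab : constant (a ++ w) <-> constant (b ++ w).
  by split; apply: constant_type; apply: type_cat => //; exact: type_sym.
have gen x x' : acts k x x' -> m <= size x -> m <= size x' ->
    ~ (constant x <-> constant x') -> K = [set: thompson]%classic.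
  move=> kx le_x le_x' xx'; have [cx|nx] := pselect (constant x).
    by apply: constant_to_nonconstant_generate Kk kx _ _ _ _ => // cx'; apply: xx'.
  apply: constant_to_nonconstant_generate (memVK subK Kk) (acts_inv kx) _ _ _ _ => //.
  by apply: contrapT => nx'; apply: xx'.
have [caa|naa] := pselect (constant (a ++ w) <-> constant (a' ++ w)); last first.
  by apply: gen ka _ _ naa; exact: size_le.
by apply: gen kb _ _ _; [exact: size_le | exact: size_le | tauto].
Qed.

Lemma nonconstant_not_stabilizer : exists g, ~ stabilizer P g.
Proof.
have [a le_a nra] := not_roomy m.
have [||e [ce le_e /= /andP []]] := @constant_away [:: a] m.
- by [].
- by rewrite /= le_a.
rewrite incompC => ae _; exists (swap a e).
apply: (swap_not_stabilizer roomP) => // [w|Pae].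
  exact/constant_roomy/constant_cat.
by apply/nra/constant_roomy; apply: constant_type ce; exact: type_sym.
Qed.

End Overgroup.

End NotAllRoomy.
End Constant.

(** * Maximality *)

Section Final.

Variable P : type_system.
Hypotheses (finP : finite_type_system P) (simpleP : simple_type_system P).

Lemma room_mono s m n : m <= n -> room P s m -> room P s n.
Proof.
move=> le_mn sm L M le_L all_L; apply: sm => //.
by apply: sub_all all_L => l; exact: leq_trans.
Qed.

Lemma stabilizer_proper_maximal :
  (exists g, ~ stabilizer P g) /\
  forall K, subgroup K -> (stabilizer P `<=` K)%classic ->
  forall g, K g -> ~ stabilizer P g -> K = [set: thompson]%classic.
Proof.
have [m0 room0] := uniform_room finP.
have [[n deep]|not_deep] := pselect (exists n, forall a, n <= size a -> roomy P a).
  pose m := maxn n m0.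
  have roomP s : roomy P s -> room P s m.
    by move=> /room0; apply: room_mono; exact: leq_maxr.
  have {}deep a : m <= size a -> roomy P a by rewrite geq_max => /andP [/deep].
  split.
    have [a [b [le_a le_b nPab]]] := deep_types_differ simpleP m.
    (* [a] and [b] may be comparable; [g] stands in for [a], with the same type and away from
       [b]. *)
    have [||g [Pg le_g /= /andP [gb _]]] := deep_room deep roomP (L := [:: b]) m le_a.
    - by [].
    - by rewrite /= le_b.
    exists (swap g b); apply: (swap_not_stabilizer roomP) => // [w|Pgb].
      by apply: deep; rewrite size_cat; lia.
    by apply: nPab; exact: type_trans Pgb.
  move=> K subK HK g Kg /(not_stabilizer m) [k [a [b [a' [b' []]]]]].
  move=> kE ka kb [Pab nPab] /and5P [le_a le_b le_a' le_b' _].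
  have Kk : K k by case: kE => ->; last exact: memVK.
  have [M kM] := acts_deep k m.
  (* [e] has the common type of [a] and [b]. Its image [e'] cannot have the type of both [a'] and
     [b'], so conjugating by [k] the swap of [e] with [a] or with [b] gives a swap of two types. *)
  have [||e [Pe le_e /= /and3P []]] := deep_room deep roomP (L := [:: a; b]) (maxn m M) le_a.
  - by [].
  - by rewrite /= le_a le_b.
  rewrite !(incompC e) => ae be _.
  move: le_e; rewrite geq_max => /andP [le_e /kM [e' ke le_e']].
  have gen x x' : acts k x x' -> P x e -> incomp x e -> m <= size x' -> ~ P x' e' ->
      K = [set: thompson]%classic.
    move=> kx Pxe xe le_x' nPxe; apply: (all_roomy_generate subK HK deep roomP) => //.
    exists x', e'; split=> //; first exact: acts_incomp xe.
    by apply: (conjK subK Kk xe kx ke); apply/HK/swap_stabilizer.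
  have [Pae|nPae] := pselect (P a' e'); last exact: gen ka _ _ _ nPae.
  apply: gen kb _ _ _ _ => // [|Pbe]; first exact: type_trans (type_sym Pab) Pe.
  by apply: nPab; exact: type_trans Pae (type_sym Pbe).
have not_roomy n : exists2 a, n <= size a & ~ roomy P a.
  apply: contrapT => no_a; apply: not_deep; exists n => a le_a.
  by apply: contrapT => nra; apply: no_a; exists a.
have [n1 child1] := nonconstant_child finP simpleP not_roomy.
have [n2 reach2] := nonconstant_reach finP simpleP.
pose m := maxn m0 (maxn n1 n2).
have roomP s : roomy P s -> room P s m.
  by move=> /room0; apply: room_mono; exact: leq_maxl.
have child a : m <= size a -> ~ constant P a ->
    exists2 c, ~ constant P (a ++ [:: c]) & constant P (a ++ [:: ~~ c]).
  by move=> le_a; apply: child1; lia.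
have reach a : ~ constant P a -> forall b, m <= size b -> exists w, P (a ++ w) b.
  by move=> na b le_b; apply: reach2 => //; lia.
split; first exact: nonconstant_not_stabilizer child roomP.
move=> K subK HK g.
exact: (not_all_roomy_generate simpleP not_roomy child reach roomP subK HK).
Qed.

End Final.

Theorem theorem5p15 (P : type_system) (finP : finite_type_system P)
  (simpleP : simple_type_system P) : maximal_subgroup (stabilizer P).
Proof.
have [[g nHg] gen] := stabilizer_proper_maximal finP simpleP.
split; first exact: stabilizer_subgroup.
  by move=> HT; apply: nHg; rewrite HT.
move=> K subK HK; have [KH|/existsNP [k /not_implyP [Kk nHk]]] :=
    pselect (forall k, K k -> stabilizer P k).
  by left; apply/seteqP.
by right; apply: gen Kk nHk.
Qed.
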